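(* Let $x$ be a real number with $0<|x|\le 1$. For all even integers $n\geq 0$ we have $$\sum_{k=1}^\infty\frac{(2x)^{2k}}{\binom{2k}{k}k(2k+n)} =\frac{\binom{n}{n/2}}{(2x)^{n}}\left((\arcsin x)^2 -\sqrt{1-x^2}\cdot\arcsin x \sum_{j=0}^{\frac{n-2}{2}}\frac{(2x)^{2j+1}}{\binom{2j}{j}(2j+1)} +\frac{1}{2}\sum_{j=1}^{\frac{n}{2}}\frac{(2x)^{2j}}{\binom{2j}{j}j^2}\right),$$ and for all odd integers $n\geq 1$, $$\sum_{k=1}^\infty\frac{(2x)^{2k}}{\binom{2k}{k}k(2k+n)} =\frac{\bigl(\frac{2}{x}\bigr)^n}{n\binom{n-1}{\frac{n-1}{2}}} \left(2\sum_{j=0}^{\frac{n-1}{2}}\frac{\binom{2j}{j}}{2j+1}\Bigl(\frac{x}{2}\Bigr)^{2j+1} -\sqrt{1-x^2}\cdot\arcsin x\sum_{j=0}^{\frac{n-1}{2}}\binom{2j}{j}\Bigl(\frac{x}{2}\Bigr)^{2j}\right).$$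
   Context: Empty sums are equal to $0$. Here $\arcsin$ is the principal real arcsine on $[-1,1]$. *)

(* Defs.v *)
From Stdlib Require Import Reals List Arith.
Open Scope R_scope.

(* Sum of [f j] over [lo <= j < hi]; the upper bound is exclusive so that an
   empty range starting at 0 can be written without truncated subtraction. *)
Definition sum_range (lo hi : nat) (f : nat -> R) : R :=
  fold_right Rplus 0 (map f (seq lo (hi - lo))).

(* Main.v *)
(** Write [x = sin t] and [w_N = 2 * 4^N / C(2N, N)].  Since
    [(sin^(2k))'' = 2k(2k-1) sin^(2k-2) - (2k)^2 sin^(2k)], the second derivative
    of [t^2 - sum_(1<=k<=N) w_k sin^(2k) / (2k)^2] telescopes to [w_N sin^(2N)].
    The first integral [r] of this remainder satisfies
    [0 <= cos * r <= w_N / (2N+1)], its second integral lies between [0] and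
    [2 w_N / (2N+1)], and [w_N] grows like the square root of [N].  This yields
    the cases [n = 0] and [n = 1] for all [|x| <= 1], endpoints included.  The
    termwise identity
    [(n+2) x^2 T(n+2,k) = (n+1) T(n,k+1) + x^2 T(1,k)] then steps from [n] to
    [n+2]. *)

Require Import Defs.
From Stdlib Require Import Reals List Arith Lia Psatz.
From Coquelicot Require Import Coquelicot.
Open Scope R_scope.

(** * Central binomial coefficients and growth of the weights [wallis] *)

Lemma C_central_S (k : nat) :
  Binomial.C (2 * S k) (S k) =
  Binomial.C (2 * k) k * (2 * (2 * INR k + 1) / (INR k + 1)).
Proof.
unfold Binomial.C.
replace (2 * S k - S k)%nat with (S k) by lia.
replace (2 * k - k)%nat with k by lia.
replace (2 * S k)%nat with (S (S (2 * k))) by lia.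
rewrite !fact_simpl, !mult_INR, !S_INR, mult_INR.
pose proof (INR_fact_neq_0 k); pose proof (pos_INR k).
simpl (INR 2); field; split; lra.
Qed.

Lemma C_central_0 : Binomial.C (2 * 0) 0 = 1.
Proof. unfold Binomial.C; simpl; field. Qed.

Lemma C_central_pos (k : nat) : 0 < Binomial.C (2 * k) k.
Proof.
unfold Binomial.C; apply Rdiv_lt_0_compat; [|apply Rmult_lt_0_compat];
  apply INR_fact_lt_0.
Qed.

(** Twice the partial Wallis product of 2i / (2i - 1) over 1 <= i <= k. *)
Definition wallis (k : nat) : R := 2 * 4 ^ k / Binomial.C (2 * k) k.

Lemma wallis_0 : wallis 0 = 2.
Proof. unfold wallis; rewrite C_central_0; simpl; field. Qed.

Lemma wallis_pos (k : nat) : 0 < wallis k.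
Proof.
apply Rdiv_lt_0_compat; [|apply C_central_pos].
pose proof (pow_lt 4 k); lra.
Qed.

Lemma wallis_S (k : nat) :
  wallis (S k) = wallis k * ((2 * INR k + 2) / (2 * INR k + 1)).
Proof.
unfold wallis; rewrite C_central_S, <- tech_pow_Rmult.
pose proof (C_central_pos k); pose proof (pos_INR k).
field; repeat split; lra.
Qed.

Lemma wallis_sqr_le (k : nat) : wallis k ^ 2 <= 8 * (2 * INR k + 1).
Proof.
(* This sharper bound is the one preserved by induction. *)
enough (wallis k ^ 2 <= 4 * (4 * INR k + 1)) by (pose proof (pos_INR k); lra).
induction k as [|k IH]; [rewrite wallis_0; simpl; lra|].
rewrite wallis_S, S_INR, Rpow_mult_distr.
pose proof (pos_INR k) as hk; set (u := INR k) in *.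
apply Rle_trans with (4 * (4 * u + 1) * ((2 * u + 2) / (2 * u + 1)) ^ 2).
  apply Rmult_le_compat_r; [apply pow2_ge_0 | exact IH].
(* The slack is explicit because (4u+1)(2u+2)^2 = (4u+5)(2u+1)^2 - 1. *)
replace (4 * (4 * u + 1) * ((2 * u + 2) / (2 * u + 1)) ^ 2)
  with (4 * (4 * (u + 1) + 1) - 4 / (2 * u + 1) ^ 2) by (field; lra).
assert (0 < 4 / (2 * u + 1) ^ 2) by (apply Rdiv_lt_0_compat; [lra | apply pow_lt; lra]).
lra.
Qed.

Definition wallis_err (N : nat) : R := wallis N / (2 * INR N + 1).

Lemma wallis_err_pos (N : nat) : 0 < wallis_err N.
Proof.
apply Rdiv_lt_0_compat; [apply wallis_pos | pose proof (pos_INR N); lra].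
Qed.

(** The bound on [wallis N ^ 2] gives [wallis_err N ^ 2 * (2N+1) <= 8], so the error decays at least
    like the inverse square root of N. *)
Lemma is_lim_seq_wallis_err : is_lim_seq wallis_err 0.
Proof.
apply is_lim_seq_spec; intros [e he]; simpl.
pose proof (pow_lt e 2 he) as he2.
(* Every N above M has e^2 N > 8, whereas [wallis_err N >= e] would force e^2 (2N+1) <= 8. *)
destruct (nfloor_ex (8 / e ^ 2)) as [M [_ hM]].
  apply Rlt_le, Rdiv_lt_0_compat; lra.
exists (S M); intros N hN; apply le_INR in hN; rewrite S_INR in hN.
pose proof (wallis_err_pos N); pose proof (pos_INR M).
rewrite Rminus_0_r, Rabs_pos_eq by lra.
apply Rnot_le_lt; intros hle.
assert (h1 : wallis_err N * (2 * INR N + 1) = wallis N) by (unfold wallis_err; field; lra).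
pose proof (wallis_sqr_le N) as h2; rewrite <- h1, Rpow_mult_distr in h2.
assert (h3 : e ^ 2 <= wallis_err N ^ 2) by (apply pow_incr; lra).
assert (h4 : 8 < e ^ 2 * INR N).
  apply Rlt_le_trans with (e ^ 2 * (INR M + 1)); [|apply Rmult_le_compat_l; lra].
  apply Rmult_lt_compat_l with (r := e ^ 2) in hM; [|lra].
  replace (e ^ 2 * (8 / e ^ 2)) with 8 in hM by (field; lra); lra.
assert (h5 : e ^ 2 * (2 * INR N + 1) ^ 2 <= 8 * (2 * INR N + 1)).
  apply Rle_trans with (2 := h2), Rmult_le_compat_r; [apply pow2_ge_0 | exact h3].
assert (h6 : e ^ 2 * (2 * INR N + 1) <= 8).
  apply Rmult_le_reg_r with (2 * INR N + 1); lra.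
nra.
Qed.

(** * The remainders as functions of the angle *)

Fixpoint asin_rem (N : nat) (t : R) : R :=
  match N with
  | O => 2 * t
  | S M => asin_rem M t - wallis (S M) / (2 * INR (S M)) * (sin t ^ (2 * M + 1) * cos t)
  end.

Fixpoint asin_sqr_rem (N : nat) (t : R) : R :=
  match N with
  | O => t ^ 2
  | S M => asin_sqr_rem M t - wallis (S M) / (2 * INR (S M)) ^ 2 * sin t ^ (2 * S M)
  end.

Lemma is_derive_eq (f : R -> R) (t l l' : R) :
  is_derive f t l -> l = l' -> is_derive f t l'.
Proof. now intros h <-. Qed.

(** This is the reduction formula for powers of sine: as w_(N+1) / (2N+2) = w_N / (2N+1), the term
    subtracted at step N+1 has derivative w_N sin^(2N) - w_(N+1) sin^(2N+2), and the sum
    telescopes. *)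
Lemma is_derive_asin_rem (N : nat) (t : R) :
  is_derive (asin_rem N) t (wallis N * sin t ^ (2 * N)).
Proof.
revert t; induction N as [|N IH]; intros t.
  rewrite wallis_0; simpl; auto_derive; [trivial | ring].
cbn [asin_rem].
remember (wallis (S N) / (2 * INR (S N))) as c eqn:hc.
remember (2 * N + 1)%nat as m eqn:hm.
eapply is_derive_eq; [apply (is_derive_minus (asin_rem N)); [apply IH | auto_derive; [trivial | reflexivity]] |].
change minus with Rminus.
replace (2 * S N)%nat with (S (S (2 * N))) by lia.
replace m with (S (2 * N)) by lia.
rewrite hc, wallis_S, !S_INR, mult_INR, Nat.pred_succ, <- !tech_pow_Rmult.
pose proof (sin2_cos2 t) as h; unfold Rsqr in h.
pose proof (pos_INR N); set (w := wallis N) in *; set (u := INR N) in *.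
set (p := sin t ^ (2 * N)) in *; simpl (INR 2).
transitivity (w * p - w * (p * ((2 * u + 1) * (cos t * cos t) - sin t * sin t)) / (2 * u + 1)).
  field; lra.
replace (cos t * cos t) with (1 - sin t * sin t) by lra; field; lra.
Qed.

Lemma is_derive_asin_sqr_rem (N : nat) (t : R) :
  is_derive (asin_sqr_rem N) t (asin_rem N t).
Proof.
revert t; induction N as [|N IH]; intros t.
  simpl; auto_derive; [trivial | ring].
cbn [asin_sqr_rem].
remember (wallis (S N) / (2 * INR (S N)) ^ 2) as c eqn:hc.
remember (2 * S N)%nat as m eqn:hm.
eapply is_derive_eq; [apply (is_derive_minus (asin_sqr_rem N)); [apply IH | auto_derive; [trivial | reflexivity]] |].
change minus with Rminus; cbn [asin_rem].
replace (2 * N + 1)%nat with (pred m) by lia.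
rewrite hc, hm, mult_INR; pose proof (pos_INR N); rewrite S_INR; simpl (INR 2).
field; lra.
Qed.

Lemma asin_rem_0 (N : nat) : asin_rem N 0 = 0.
Proof.
induction N as [|N IH]; simpl; [ring|].
rewrite IH, sin_0, Nat.add_comm; simpl; ring.
Qed.

Lemma asin_sqr_rem_0 (N : nat) : asin_sqr_rem N 0 = 0.
Proof.
induction N as [|N IH]; cbn [asin_sqr_rem]; [ring|].
rewrite IH, sin_0, pow_ne_zero by lia; ring.
Qed.

(** * Bounds on the remainders by comparing derivatives *)

Lemma nonneg_of_derive_nonneg (f f' : R -> R) (b : R) :
  0 <= f 0 ->
  (forall t, is_derive f t (f' t)) ->
  (forall t, 0 <= t <= b -> 0 <= f' t) ->
  forall t, 0 <= t <= b -> 0 <= f t.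
Proof.
intros h0 hd hp t ht.
destruct (MVT_gen f 0 t f') as [c [hc he]].
- intros; apply hd.
- intros y _; apply derivable_continuous_pt; exists (f' y).
  apply is_derive_Reals, hd.
- rewrite Rmin_left, Rmax_right in hc by lra.
  assert (0 <= f' c) by (apply hp; lra).
  nra.
Qed.

(** A weak Jordan inequality, with 1/2 in place of 2/PI. For v = u/2, the bound sin v >= v cos v
    gives sin u = 2 sin v cos v >= 2v cos^2 v = v (1 + cos u) >= v. *)
Lemma half_le_sin (u : R) : 0 <= u <= PI / 2 -> u / 2 <= sin u.
Proof.
intros hu; pose proof PI_RGT_0.
assert (h : 0 <= sin (u / 2) - u / 2 * cos (u / 2)).
  apply (nonneg_of_derive_nonneg (fun v => sin v - v * cos v) (fun v => v * sin v) PI).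
  - rewrite sin_0; lra.
  - intros v; auto_derive; [trivial | ring].
  - intros v hv; apply Rmult_le_pos; [|apply sin_ge_0]; lra.
  - lra.
assert (hc : 0 <= cos (u / 2)) by (apply cos_ge_0; lra).
assert (hcu : 0 <= cos u) by (apply cos_ge_0; lra).
assert (hs2 : sin u = 2 * sin (u / 2) * cos (u / 2)) by (rewrite <- sin_2a; f_equal; field).
assert (hc2 : cos u = 2 * cos (u / 2) * cos (u / 2) - 1) by (rewrite <- cos_2a_cos; f_equal; field).
assert (0 <= (sin (u / 2) - u / 2 * cos (u / 2)) * cos (u / 2)) by (apply Rmult_le_pos; lra).
assert (0 <= u / 2 * cos u) by (apply Rmult_le_pos; lra).
rewrite hc2 in *; lra.
Qed.

Lemma asin_rem_nonneg (N : nat) (t : R) : 0 <= t <= PI / 2 -> 0 <= asin_rem N t.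
Proof.
apply (nonneg_of_derive_nonneg _ (fun t => wallis N * sin t ^ (2 * N))).
- rewrite asin_rem_0; lra.
- apply is_derive_asin_rem.
- intros s hs; pose proof (wallis_pos N); pose proof PI_RGT_0.
  apply Rmult_le_pos; [lra | apply pow_le, sin_ge_0; lra].
Qed.

Lemma asin_sqr_rem_nonneg (N : nat) (t : R) : 0 <= t <= PI / 2 -> 0 <= asin_sqr_rem N t.
Proof.
apply (nonneg_of_derive_nonneg _ (asin_rem N)).
- rewrite asin_sqr_rem_0; lra.
- apply is_derive_asin_sqr_rem.
- apply asin_rem_nonneg.
Qed.

Lemma is_derive_wallis_err_sin (N : nat) (t : R) :
  is_derive (fun t => wallis_err N * sin t ^ (2 * N + 1)) t
    (cos t * (wallis N * sin t ^ (2 * N))).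
Proof.
remember (2 * N + 1)%nat as m eqn:hm.
auto_derive; [trivial|].
replace m with (S (2 * N)) by lia.
rewrite Nat.pred_succ, S_INR, mult_INR; simpl (INR 2).
unfold wallis_err; pose proof (pos_INR N); field; lra.
Qed.

(** In the derivative of the difference the powers of sine cancel, leaving sin t times
    [asin_rem N t]. The factor cos t matters at the endpoint: [asin_rem N (PI / 2)] equals PI for
    every N. *)
Lemma cos_asin_rem_le (N : nat) (t : R) :
  0 <= t <= PI / 2 -> cos t * asin_rem N t <= wallis_err N * sin t ^ (2 * N + 1).
Proof.
intros ht; apply Rminus_le_0.
apply (nonneg_of_derive_nonneg
  (fun t => wallis_err N * sin t ^ (2 * N + 1) - cos t * asin_rem N t)
  (fun t => sin t * asin_rem N t) (PI / 2)).
- rewrite sin_0, asin_rem_0, pow_ne_zero by lia; lra.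
- intros s.
  eapply is_derive_eq; [apply (is_derive_minus (fun t => wallis_err N * sin t ^ (2 * N + 1)));
    [apply is_derive_wallis_err_sin | apply (is_derive_mult cos);
      [apply is_derive_cos | apply is_derive_asin_rem | apply Rmult_comm]] |].
  change minus with Rminus; change plus with Rplus; change mult with Rmult; ring.
- intros s hs; pose proof PI_RGT_0; apply Rmult_le_pos;
    [apply sin_ge_0; lra | apply asin_rem_nonneg, hs].
- exact ht.
Qed.

Lemma asin_sqr_rem_le (N : nat) (t : R) :
  0 <= t <= PI / 2 -> asin_sqr_rem N t <= 2 * (wallis_err N * sin t ^ (2 * N + 1)).
Proof.
intros ht.
(* Adding [(PI/2 - t) * asin_rem N t] makes the derivative a multiple of
   [wallis N * sin t ^ (2 * N)], so Jordan's inequality applies. *)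
enough (h : 0 <= 2 * (wallis_err N * sin t ^ (2 * N + 1))
                 - (asin_sqr_rem N t + (PI / 2 - t) * asin_rem N t)).
  pose proof (asin_rem_nonneg N t ht); nra.
apply (nonneg_of_derive_nonneg
  (fun t => 2 * (wallis_err N * sin t ^ (2 * N + 1))
            - (asin_sqr_rem N t + (PI / 2 - t) * asin_rem N t))
  (fun t => (2 * cos t - (PI / 2 - t)) * (wallis N * sin t ^ (2 * N))) (PI / 2)).
- rewrite sin_0, asin_rem_0, asin_sqr_rem_0, pow_ne_zero by lia; lra.
- intros s.
  eapply is_derive_eq; [apply (is_derive_minus (fun t => 2 * (wallis_err N * sin t ^ (2 * N + 1))));
    [apply is_derive_scal, is_derive_wallis_err_sin
    | apply (is_derive_plus (asin_sqr_rem N)); [apply is_derive_asin_sqr_rem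
      | apply (is_derive_mult (fun t => PI / 2 - t));
        [auto_derive; [trivial | reflexivity] | apply is_derive_asin_rem | apply Rmult_comm]]] |].
  change minus with Rminus; change plus with Rplus; change mult with Rmult; ring.
- intros s hs; pose proof PI_RGT_0; pose proof (wallis_pos N).
  apply Rmult_le_pos; [|apply Rmult_le_pos; [lra | apply pow_le, sin_ge_0; lra]].
  (* With u = PI/2 - s the required sign is u <= 2 sin u. *)
  rewrite <- sin_shift.
  pose proof (half_le_sin (PI / 2 - s)); lra.
- exact ht.
Qed.

(** * Partial sums for n = 0 and n = 1 *)

Definition term (x : R) (n k : nat) : R :=
  (2 * x) ^ (2 * k) / (Binomial.C (2 * k) k * INR k * INR (2 * k + n)).

Lemma term_wallis (x : R) (n k : nat) :
  term x n (S k) =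
  wallis (S k) * x ^ (2 * S k) / (2 * INR (S k) * (2 * INR (S k) + INR n)).
Proof.
unfold term, wallis.
rewrite Rpow_mult_distr, pow_mult, plus_INR, mult_INR.
replace (2 ^ 2) with 4 by ring; simpl (INR 2).
pose proof (C_central_pos (S k)); pose proof (pos_INR n); pose proof (lt_0_INR (S k) (Nat.lt_0_succ k)).
field; lra.
Qed.

Lemma term_opp (x : R) (n k : nat) : term (- x) n k = term x n k.
Proof.
unfold term; rewrite !pow_mult; f_equal; f_equal; ring.
Qed.

(** Each term is a difference of consecutive remainders. The sum covers k = 1 to N+1, hence the
    index [S N]. *)
Lemma sum_term_0 (t : R) (N : nat) :
  sum_n (fun i => term (sin t) 0 (S i)) N = t ^ 2 - asin_sqr_rem (S N) t.
Proof.
assert (hs : forall M, term (sin t) 0 (S M) = asin_sqr_rem M t - asin_sqr_rem (S M) t).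
  intros M; rewrite term_wallis; cbn [asin_sqr_rem]; simpl (INR 0).
  pose proof (lt_0_INR (S M) (Nat.lt_0_succ M)); field; lra.
induction N as [|N IH]; [rewrite sum_O, hs; reflexivity|].
rewrite sum_Sn, IH, hs; apply Rminus_diag_uniq; change plus with Rplus; ring.
Qed.

(** Telescopes with E_M = sin t cos t [asin_rem M t] - [wallis_err M] sin^(2M+2). The factor sin^2
    avoids a division by zero and is the x^2 that appears in the recurrence on n. *)
Lemma sum_term_1 (t : R) (N : nat) :
  sum_n (fun i => sin t ^ 2 * term (sin t) 1 (S i)) N =
  2 * sin t ^ 2 - 2 * (sin t * cos t * t)
  + (sin t * (cos t * asin_rem (S N) t) - wallis_err (S N) * sin t ^ (2 * S N + 2)).
Proof.
assert (hs : forall M, sin t ^ 2 * term (sin t) 1 (S M) =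
  (sin t * (cos t * asin_rem (S M) t) - wallis_err (S M) * sin t ^ (2 * S M + 2))
  - (sin t * (cos t * asin_rem M t) - wallis_err M * sin t ^ (2 * M + 2))).
  intros M; rewrite term_wallis; unfold wallis_err; cbn [asin_rem]; simpl (INR 1).
  rewrite wallis_S, S_INR.
  replace (2 * S M + 2)%nat with (S (S (S (S (2 * M))))) by lia.
  replace (2 * S M)%nat with (S (S (2 * M))) by lia.
  replace (2 * M + 2)%nat with (S (S (2 * M))) by lia.
  replace (2 * M + 1)%nat with (S (2 * M)) by lia.
  rewrite <- !tech_pow_Rmult.
  pose proof (cos2 t) as hc; unfold Rsqr in hc.
  pose proof (pos_INR M); set (u := INR M) in *; set (p := sin t ^ (2 * M)).
  set (w := wallis M).
  (* Isolates cos^2, so that replacing it by 1 - sin^2 leaves a rational identity. *)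
  replace (sin t * (cos t * (asin_rem M t - w * ((2 * u + 2) / (2 * u + 1)) / (2 * (u + 1)) * (sin t * p * cos t))))
    with (sin t * (cos t * asin_rem M t) - w / (2 * u + 1) * (sin t * sin t * p * (cos t * cos t)))
    by (field; lra).
  rewrite hc; field; lra.
(* The closed form is exactly -E_0, so the partial sum is E_(N+1) - E_0. *)
assert (h0 : 2 * sin t ^ 2 - 2 * (sin t * cos t * t) =
  - (sin t * (cos t * asin_rem 0 t) - wallis_err 0 * sin t ^ (2 * 0 + 2))).
  unfold wallis_err; rewrite wallis_0; simpl; field.
rewrite h0.
induction N as [|N IH]; [rewrite sum_O, hs; apply Rminus_diag_uniq; ring|].
rewrite sum_Sn, IH, hs; apply Rminus_diag_uniq; change plus with Rplus; ring.
Qed.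

(** * Convergence for n = 0 and n = 1, endpoints included *)

Lemma is_lim_seq_of_err (u : nat -> R) (l K : R) :
  (forall N, Rabs (u N - l) <= K * wallis_err (S N)) -> is_lim_seq u l.
Proof.
intros h.
assert (hK : is_lim_seq (fun N => K * wallis_err (S N)) 0).
  replace (Finite 0) with (Rbar_mult K 0) by (simpl; f_equal; ring).
  apply is_lim_seq_scal_l, (is_lim_seq_incr_1 wallis_err), is_lim_seq_wallis_err.
apply is_lim_seq_ext with (fun N => (u N - l) + l); [intros; ring|].
replace (Finite l) with (Finite (0 + l)) by (f_equal; ring).
apply is_lim_seq_plus'; [|apply is_lim_seq_const].
apply is_lim_seq_abs_0, (is_lim_seq_le_le (fun _ => 0) _ (fun N => K * wallis_err (S N))).
- intros N; split; [apply Rabs_pos | apply h].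
- apply is_lim_seq_const.
- exact hK.
Qed.

Lemma wallis_err_sin_bound (N m : nat) (t : R) :
  0 <= t <= PI / 2 -> 0 <= wallis_err N * sin t ^ m <= wallis_err N.
Proof.
intros ht; pose proof PI_RGT_0; pose proof (wallis_err_pos N).
assert (h : 0 <= sin t ^ m <= 1).
  assert (hs : 0 <= sin t <= 1) by (split; [apply sin_ge_0; lra | apply SIN_bound]).
  split; [apply pow_le; lra|].
  rewrite <- (pow1 m); apply pow_incr; lra.
nra.
Qed.

Lemma is_series_term_0_sin (t : R) :
  0 <= t <= PI / 2 -> is_series (fun i => term (sin t) 0 (S i)) (t ^ 2).
Proof.
intros ht; apply (is_lim_seq_of_err _ _ 2); intros N.
rewrite sum_term_0.
pose proof (asin_sqr_rem_nonneg (S N) t ht).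
pose proof (asin_sqr_rem_le (S N) t ht).
pose proof (wallis_err_sin_bound (S N) (2 * S N + 1) t ht).
apply Rabs_le; lra.
Qed.

Lemma is_series_term_1_sin (t : R) :
  0 <= t <= PI / 2 ->
  is_series (fun i => sin t ^ 2 * term (sin t) 1 (S i))
    (2 * sin t ^ 2 - 2 * (sin t * cos t * t)).
Proof.
(* The constant 1 suffices: the error is a difference of two quantities that both lie between 0 and
   [wallis_err (S N)]. *)
intros ht; apply (is_lim_seq_of_err _ _ 1); intros N.
rewrite sum_term_1; pose proof PI_RGT_0.
pose proof (wallis_err_sin_bound (S N) (2 * S N + 1) t ht).
pose proof (wallis_err_sin_bound (S N) (2 * S N + 2) t ht).
assert (h1 : 0 <= cos t * asin_rem (S N) t)
  by (apply Rmult_le_pos; [apply cos_ge_0; lra | apply asin_rem_nonneg, ht]).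
pose proof (cos_asin_rem_le (S N) t ht).
assert (0 <= sin t <= 1) by (split; [apply sin_ge_0; lra | apply SIN_bound]).
assert (0 <= sin t * (cos t * asin_rem (S N) t) <= wallis_err (S N)) by nra.
apply Rabs_le; lra.
Qed.

Lemma is_series_term_0_1 (x : R) :
  -1 <= x <= 1 ->
  is_series (fun i => term x 0 (S i)) (asin x ^ 2) /\
  is_series (fun i => x ^ 2 * term x 1 (S i))
    (2 * x ^ 2 - 2 * x * (sqrt (1 - x ^ 2) * asin x)).
Proof.
(* Both series and both sums are even in x, since arcsin is odd; this reduces the claim to angles in
   [0, PI/2]. *)
assert (pos : forall y, 0 <= y <= 1 ->
  is_series (fun i => term y 0 (S i)) (asin y ^ 2) /\
  is_series (fun i => y ^ 2 * term y 1 (S i))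
    (2 * y ^ 2 - 2 * y * (sqrt (1 - y ^ 2) * asin y))).
  intros y hy.
  assert (ht : 0 <= asin y <= PI / 2).
    split; [|apply asin_bound].
    apply Rnot_lt_le; intros hlt; pose proof (asin_bound y); pose proof PI_RGT_0.
    apply sin_lt_0_var in hlt; [rewrite sin_asin in hlt|]; lra.
  pose proof (is_series_term_0_sin _ ht) as h0.
  pose proof (is_series_term_1_sin _ ht) as h1.
  rewrite sin_asin in h0, h1 by lra.
  rewrite cos_asin in h1 by lra.
  split; [exact h0|].
  replace (2 * y * (sqrt (1 - y ^ 2) * asin y)) with (2 * (y * sqrt (1 - y²) * asin y))
    by (rewrite Rsqr_pow2; ring).
  exact h1.
intros hx; destruct (Rle_dec 0 x) as [h|h]; [apply pos; lra|].
destruct (pos (- x)) as [h0 h1]; [lra|].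
rewrite asin_opp in h0, h1.
split.
- replace (asin x ^ 2) with ((- asin x) ^ 2) by ring.
  apply is_series_ext with (2 := h0); intros; apply term_opp.
- replace ((- x) ^ 2) with (x ^ 2) in h1 by ring.
  replace (2 * x * (sqrt (1 - x ^ 2) * asin x))
    with (2 * - x * (sqrt (1 - x ^ 2) * - asin x)) by ring.
  apply is_series_ext with (2 := h1); intros; rewrite term_opp; reflexivity.
Qed.

(** * The recurrence from n to n + 2 *)

Lemma term_recurrence (x : R) (n k : nat) :
  INR (n + 2) * x ^ 2 * term x (n + 2) (S k) =
  INR (n + 1) * term x n (S (S k)) + x ^ 2 * term x 1 (S k).
Proof.
rewrite !term_wallis, (wallis_S (S k)), !plus_INR, !S_INR.
replace (2 * S (S k))%nat with (2 + 2 * S k)%nat by lia.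
rewrite pow_add; simpl (INR 1); simpl (INR 2); simpl (INR 0).
pose proof (pos_INR n); pose proof (pos_INR k).
(* With K = k+1, dividing by w_K x^(2K+2) leaves the partial fractions (n+2) / (2K(2K+n+2)) = (n+1)
   / ((2K+1)(2K+n+2)) + 1 / (2K(2K+1)). *)
field; repeat split; lra.
Qed.

Lemma is_series_term_step (x : R) (n : nat) (s : R) :
  -1 <= x <= 1 -> x <> 0 ->
  is_series (fun i => term x n (S i)) s ->
  is_series (fun i => term x (n + 2) (S i))
    ((INR (n + 1) * s + 2 * x ^ 2 / INR (n + 2) - 2 * x * (sqrt (1 - x ^ 2) * asin x))
     / (INR (n + 2) * x ^ 2)).
Proof.
intros hx hx0 hs.
destruct (is_series_term_0_1 x hx) as [_ h1].
assert (hn : 0 < INR (n + 2)) by (apply lt_0_INR; lia).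
assert (hx2 : x ^ 2 <> 0) by (apply pow_nonzero, hx0).
apply is_series_ext with (fun i => / (INR (n + 2) * x ^ 2) *
  (INR (n + 1) * term x n (S (S i)) + x ^ 2 * term x 1 (S i))).
  intros i; rewrite <- term_recurrence.
  apply Rminus_diag_uniq; field; lra.
(* The shifted series lacks its first term T(n,1) = 2x^2 / (n+2). *)
assert (h2 : is_series (fun i => term x n (S (S i))) (s - 2 * x ^ 2 / INR (n + 2))).
  apply (is_series_incr_1 (fun i => term x n (S i))).
  replace (plus _ _) with s; [exact hs|].
  change plus with Rplus; rewrite term_wallis, wallis_S, wallis_0, plus_INR.
  change (2 * 1)%nat with 2%nat.
  rewrite plus_INR in hn; simpl (INR 1); simpl (INR 0); simpl (INR 2) in *.
  field; lra.
match goal with |- is_series _ ?l =>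
  replace l with (/ (INR (n + 2) * x ^ 2) *
    (INR (n + 1) * (s - 2 * x ^ 2 / INR (n + 2))
     + (2 * x ^ 2 - 2 * x * (sqrt (1 - x ^ 2) * asin x)))) end.
- apply (is_series_scal_l (K := R_AbsRing) (INR (n + 1))) in h2.
  exact (is_series_scal_l (K := R_AbsRing) _ _ _ (is_series_plus _ _ _ _ h2 h1)).
- rewrite !plus_INR in *; simpl (INR 1); simpl (INR 2) in *; field; lra.
Qed.

(** * Closed forms by induction on n in each parity *)

Lemma sum_range_S (lo hi : nat) (f : nat -> R) :
  (lo <= hi)%nat -> sum_range lo (S hi) f = sum_range lo hi f + f hi.
Proof.
intros h; unfold sum_range.
replace (S hi - lo)%nat with (S (hi - lo)) by lia.
rewrite seq_S, map_app, fold_right_app; simpl.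
replace (lo + (hi - lo))%nat with hi by lia.
(* [fold_right] now starts from the last value; induction on the list moves it outside. *)
induction (map f (seq lo (hi - lo))) as [|a l IH]; simpl; [ring|].
rewrite IH; ring.
Qed.

(** For n = 2m, passing to m+1 multiplies the prefactor by (n+1) / ((n+2) x^2), the coefficient of
    the recurrence. Its two remaining contributions are the new last terms of the two finite
    sums. *)
Lemma is_series_term_even (x : R) (m : nat) :
  -1 <= x <= 1 -> x <> 0 ->
  is_series (fun i => term x (2 * m) (S i))
    (Binomial.C (2 * m) m / (2 * x) ^ (2 * m) *
      ((asin x) ^ 2
       - sqrt (1 - x ^ 2) * asin x *
           sum_range 0 m
             (fun j => (2 * x) ^ (2 * j + 1) / (Binomial.C (2 * j) j * INR (2 * j + 1)))
       + 1 / 2 *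
           sum_range 1 (m + 1)
             (fun j => (2 * x) ^ (2 * j) / (Binomial.C (2 * j) j * INR j ^ 2)))).
Proof.
intros hx hx0; induction m as [|m IH].
  rewrite C_central_0; unfold sum_range; simpl fold_right.
  match goal with |- is_series _ ?l => replace l with (asin x ^ 2) by (simpl; field) end.
  exact (proj1 (is_series_term_0_1 x hx)).
apply is_series_term_step in IH; [|assumption..].
replace (2 * m + 2)%nat with (2 * S m)%nat in IH by lia.
match type of IH with is_series _ ?l => match goal with |- is_series _ ?l' =>
  replace l' with l; [exact IH|] end end.
replace (S m + 1)%nat with (S (m + 1)) by lia.
rewrite !sum_range_S by lia.
(* With the last terms split off, the old sums and the arcsine factor are arbitrary reals in a
   rational identity. *)
generalize (sum_range 0 m (fun j => (2 * x) ^ (2 * j + 1) / (Binomial.C (2 * j) j * INR (2 * j + 1)))) as P.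
generalize (sum_range 1 (m + 1) (fun j => (2 * x) ^ (2 * j) / (Binomial.C (2 * j) j * INR j ^ 2))) as Q.
generalize (sqrt (1 - x ^ 2) * asin x) as B; intros B Q P.
replace (m + 1)%nat with (S m) by lia; rewrite C_central_S.
replace (2 * S m)%nat with (2 * m + 2)%nat by lia.
rewrite !pow_add, !plus_INR, mult_INR, (S_INR m); simpl (INR 1); simpl (INR 2).
assert (hp : (2 * x) ^ (2 * m) <> 0) by (apply pow_nonzero; lra).
pose proof (C_central_pos m); pose proof (pos_INR m).
field; repeat split; lra.
Qed.

(** The same matching of prefactors, now with n = 2m+1 and the case n = 1 as base. *)
Lemma is_series_term_odd (x : R) (m : nat) :
  -1 <= x <= 1 -> x <> 0 ->
  is_series (fun i => term x (2 * m + 1) (S i))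
    ((2 / x) ^ (2 * m + 1) / (INR (2 * m + 1) * Binomial.C (2 * m) m) *
      (2 * sum_range 0 (m + 1)
             (fun j => Binomial.C (2 * j) j / INR (2 * j + 1) * (x / 2) ^ (2 * j + 1))
       - sqrt (1 - x ^ 2) * asin x *
           sum_range 0 (m + 1)
             (fun j => Binomial.C (2 * j) j * (x / 2) ^ (2 * j)))).
Proof.
intros hx hx0; induction m as [|m IH].
  destruct (is_series_term_0_1 x hx) as [_ h1].
  (* The base series carries a factor x^2, removed here because x is nonzero. *)
  apply (is_series_scal_l (K := R_AbsRing) (/ x ^ 2)) in h1.
  assert (hx2 : x ^ 2 <> 0) by (apply pow_nonzero, hx0).
  rewrite C_central_0; unfold sum_range; cbn [seq Nat.add Nat.sub map fold_right].
  rewrite C_central_0.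
  match type of h1 with is_series _ ?l => match goal with |- is_series _ ?l' =>
    replace l' with l end end.
    apply is_series_ext with (2 := h1); intros i.
    change (@scal R_AbsRing _) with Rmult; apply Rminus_diag_uniq.
    simpl (2 * 0 + 1)%nat; field; lra.
  change (@scal R_AbsRing _) with Rmult; simpl; field; lra.
apply is_series_term_step in IH; [|assumption..].
replace (2 * m + 1 + 2)%nat with (2 * S m + 1)%nat in IH by lia.
match type of IH with is_series _ ?l => match goal with |- is_series _ ?l' =>
  replace l' with l; [exact IH|] end end.
replace (S m + 1)%nat with (S (m + 1)) by lia.
rewrite !(sum_range_S 0 (m + 1)) by lia.
generalize (sum_range 0 (m + 1) (fun j => Binomial.C (2 * j) j / INR (2 * j + 1) * (x / 2) ^ (2 * j + 1))) as U.
generalize (sum_range 0 (m + 1) (fun j => Binomial.C (2 * j) j * (x / 2) ^ (2 * j))) as V.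
generalize (sqrt (1 - x ^ 2) * asin x) as B; intros B V U.
replace (m + 1)%nat with (S m) by lia; rewrite C_central_S.
replace (2 * S m)%nat with (2 * m + 2)%nat by lia.
rewrite !pow_add, !plus_INR, mult_INR; simpl (INR 1); simpl (INR 2).
(* Expresses both powers through one nonzero quantity p = (2/x)^(2m). *)
replace ((x / 2) ^ (2 * m)) with (/ (2 / x) ^ (2 * m))
  by (rewrite <- pow_inv; f_equal; field; exact hx0).
assert (hp : (2 / x) ^ (2 * m) <> 0)
  by (apply pow_nonzero, Rmult_integral_contrapositive_currified; [lra | apply Rinv_neq_0_compat, hx0]).
generalize dependent ((2 / x) ^ (2 * m)); intros p hp.
pose proof (C_central_pos m); pose proof (pos_INR m).
field; repeat split; lra.
Qed.

Theorem theorem5p2 (x : R) (hx : 0 < Rabs x <= 1) :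
  (forall n : nat, Nat.Even n ->
     is_series
       (fun i : nat =>
          let k := S i in
          (2 * x) ^ (2 * k) / (Binomial.C (2 * k) k * INR k * INR (2 * k + n)))
       (Binomial.C n (n / 2) / (2 * x) ^ n *
          ((asin x) ^ 2
           - sqrt (1 - x ^ 2) * asin x *
               sum_range 0 (n / 2)
                 (fun j => (2 * x) ^ (2 * j + 1) / (Binomial.C (2 * j) j * INR (2 * j + 1)))
           + 1 / 2 *
               sum_range 1 (n / 2 + 1)
                 (fun j => (2 * x) ^ (2 * j) / (Binomial.C (2 * j) j * INR j ^ 2)))))
  /\
  (forall n : nat, Nat.Odd n ->
     is_series
       (fun i : nat =>
          let k := S i in
          (2 * x) ^ (2 * k) / (Binomial.C (2 * k) k * INR k * INR (2 * k + n)))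
       ((2 / x) ^ n / (INR n * Binomial.C (n - 1) ((n - 1) / 2)) *
          (2 * sum_range 0 ((n - 1) / 2 + 1)
                 (fun j => Binomial.C (2 * j) j / INR (2 * j + 1) * (x / 2) ^ (2 * j + 1))
           - sqrt (1 - x ^ 2) * asin x *
               sum_range 0 ((n - 1) / 2 + 1)
                 (fun j => Binomial.C (2 * j) j * (x / 2) ^ (2 * j))))).
Proof.
destruct hx as [h0 h1].
assert (hx0 : x <> 0) by (intros ->; rewrite Rabs_R0 in h0; lra).
apply Rabs_le_between in h1.
split; intros n [m ->].
- replace (2 * m / 2)%nat with m by (rewrite Nat.mul_comm, Nat.div_mul; lia).
  exact (is_series_term_even x m h1 hx0).
- replace (2 * m + 1 - 1)%nat with (2 * m)%nat by lia.
  replace (2 * m / 2)%nat with m by (rewrite Nat.mul_comm, Nat.div_mul; lia).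
  exact (is_series_term_odd x m h1 hx0).
Qed.
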